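(* Let $p$ be a prime, $q$ a power of $p$, and let $f(T)=\sum_{i\geq -k}a_iT^{-i}\in\mathbb{F}_q((T^{-1}))$ be a Laurent series which is algebraic and irrational over $\mathbb{F}_q(T)$. Let $s$ be the cardinality of the $p$-kernel of the sequence $\mathbf a=(a_i)_{i\geq 0}$, and let $e$ be the number of states of the minimal $p$-automaton (in direct reading) generating $\mathbf a$. Then the irrationality exponent of $f$ satisfies $$\mu(f)\leq p^{s+1}e.$$
   Context: Fix a real number $|T|>1$ and define on $\mathbb{F}_q((T^{-1}))$ the absolute value $|f|=|T|^{-i_0}$ if $f=\sum_{i\ge i_0}a_iT^{-i}$ with $a_{i_0}\neq0$ (and $|0|=0$); on $\mathbb{F}_q(T)$ this gives $|P/Q|=|T|^{\deg P-\deg Q}$. The irrationality exponent $\mu(f)$ is the supremum of the real numbers $\tau$ such that $|f-P/Q|<|Q|^{-\tau}$ has infinitely many solutions $(P,Q)\in\mathbb{F}_q[T]^2$, $Q\neq0$. The $p$-kernel of a sequence $(a_i)_{i\ge0}$ is the set of all subsequences $(a_{p^n i+l})_{i\ge0}$ with $n\ge0$, $0\le l<p^n$. A $p$-automaton (DFAO) is $(Q,\delta,q_0,\Delta,\varphi)$ with finite state set $Q$, transition function $\delta:Q\times\{0,\dots,p-1\}\to Q$, initial state $q_0$, output map $\varphi:Q\to\Delta$; it generates $(a_i)$ in direct reading if $a_i=\varphi(\delta(q_0,W))$ for every word $W$ which is a base-$p$ expansion of $i$ read from the most significant digit. By Christol's theorem the sequence $\mathbf a$ of an algebraic series is $p$-automatic,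 so $s$ and $e$ are finite. *)

(* Defs.v *)
From HB Require Import structures.
From mathcomp Require Import all_boot all_order all_algebra.
From mathcomp Require Import all_classical all_reals.
From mathcomp Require Import ereal exp.
Set Implicit Arguments. Unset Strict Implicit. Unset Printing Implicit Defensive.
Import Order.TTheory GRing.Theory Num.Theory.
Local Open Scope ring_scope.
Local Open Scope classical_set_scope.

(* A Laurent series  h = sum_i h i * T^{-i}  in F((T^{-1})) is represented by the
   function  h : int -> F  giving the coefficient of T^{-i} at index i;
   genuine Laurent series are those that are bounded below (h i = 0 for i << 0). *)
Section Laurent.
Variable F : fieldType.

Definition bounded_below (h : int -> F) (k : nat) : Prop :=
  forall i : int, i < - (k%:Z) -> h i = 0.

(* product of two Laurent series both vanishing below index -N:
   coefficient of T^{-n} is  sum_{i+j=n} f i * g j, with i,j >= -N *)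
Definition lmulN (N : nat) (f g : int -> F) (n : int) : F :=
  if n + (2 * N)%:Z < 0 then 0 else
  \sum_(i < (absz (n + (2 * N)%:Z)).+1) f (i%:Z - N%:Z) * g (n - i%:Z + N%:Z).

Definition lone : int -> F := fun i => (i == 0)%:R.

Fixpoint lpow (k : nat) (f : int -> F) (j : nat) : int -> F :=
  match j with
  | 0 => lone
  | j'.+1 => lmulN (k * j'.+1) f (lpow k f j')
  end.

(* a polynomial Q(T) = sum_d Q_d T^d as a Laurent series (T^d has index -d) *)
Definition polyL (Q : {poly F}) : int -> F :=
  fun n => if n <= 0 then Q`_(absz n) else 0.

Definition lpmul (Q : {poly F}) (h : int -> F) : int -> F :=
  fun n => \sum_(d < size Q) Q`_d * h (n + d%:Z).

Definition lsub (f g : int -> F) : int -> F := fun n => f n - g n.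

Definition lalgebraic (k : nat) (f : int -> F) : Prop :=
  exists P : {poly {poly F}}, P != 0 /\
    forall n : int, \sum_(j < size P) lpmul P`_j (lpow k f j) n = 0.

Definition lrational (f : int -> F) : Prop :=
  exists P Q : {poly F}, Q != 0 /\ lpmul Q f = polyL P.

End Laurent.

Section Norm.
Variable R : realType.
Variable F : fieldType.

Definition lead_index (h : int -> F) (i0 : int) : Prop :=
  h i0 != 0 /\ forall i, i < i0 -> h i = 0.

(* |h| = base^{-i0} with i0 the leading index, |0| = 0 ; base plays |T| > 1 *)
Definition lnorm (base : R) (h : int -> F) : R :=
  if `[< exists i0, lead_index h i0 >] then base ^ (- xget 0 (lead_index h))
  else 0.

(* |f - P/Q| < |Q|^{-tau}, where P/Q is expanded as the (unique) Laurent
   series r with Q r = P *)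
Definition approx_sol (base : R) (f : int -> F) (tau : R)
    (PQ : {poly F} * {poly F}) : Prop :=
  PQ.2 != 0 /\
  exists r : int -> F, (exists k, bounded_below r k) /\
    lpmul PQ.2 r = polyL PQ.1 /\
    lnorm base (lsub f r) < powR (lnorm base (polyL PQ.2)) (- tau).

Definition irr_exponent (base : R) (f : int -> F) : \bar R :=
  ereal_sup [set tau%:E | tau in
     [set tau : R | infinite_set [set PQ | approx_sol base f tau PQ]]].
End Norm.

Definition p_kernel {T : Type} (p : nat) (a : nat -> T) : set (nat -> T) :=
  [set b | exists n l : nat, (l < p ^ n)%N /\ b = (fun i => a (p ^ n * i + l)%N)].

Record dfao (p : nat) (D : Type) := Dfao {
  dfao_state : finType;
  dfao_delta : dfao_state -> 'I_p -> dfao_state;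
  dfao_init : dfao_state;
  dfao_out : dfao_state -> D }.

Definition word_val (p : nat) (W : seq 'I_p) : nat :=
  foldl (fun acc (d : 'I_p) => acc * p + d)%N 0%N W.

(* the automaton generates a in direct reading: for every word W (leading
   zeros allowed, empty word = 0), a (value W) = output after reading W *)
Definition generates (p : nat) (D : Type) (A : dfao p D) (a : nat -> D) : Prop :=
  forall W : seq 'I_p,
    a (word_val W) = @dfao_out p D A (foldl (@dfao_delta p D A) (@dfao_init p D A) W).

Definition min_states (p : nat) (D : Type) (a : nat -> D) (e : nat) : Prop :=
  (exists A : dfao p D, generates A a /\ #|@dfao_state p D A| = e) /\
  (forall A : dfao p D, generates A a -> (e <= #|@dfao_state p D A|)%N).

(* Main.v *)
Require Import Defs.
From HB Require Import structures.
From mathcomp Require Import all_boot all_order all_algebra.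
From mathcomp Require Import all_classical all_reals.
From mathcomp Require Import ereal exp.
From mathcomp Require Import zify.
Import Order.TTheory GRing.Theory Num.Theory.
Local Open Scope ring_scope.
Local Open Scope classical_set_scope.

(* If the p-kernel of a has s elements b_j, then each of the s+1 series
   a(T^(p^i)), i <= s, is (up to a power of T) a polynomial combination of the s
   series b_j(T^(p^s)); hence f satisfies a Mahler equation
   sum_(i <= s) A_i(T) f(T^(p^i)) = B(T) with polynomials A_i, not all zero.
   Let eps = f - P/Q have leading index v and let W = prod_(i <= s) Q(T^(p^i)).
   Then W * sum_i A_i eps(T^(p^i)) is a polynomial.  If it is nonzero, its order
   is at most 0, whence v <= deg W + O(1) <= p^(s+1) deg Q + O(1).  If it is zero,
   the lowest nonzero term A_m eps(T^(p^m)) has to be compensated by terms whose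
   order in eps is at least twice as large, whence v = O(1).  So an exponent
   greater than p^(s+1) leaves finitely many Q, and then finitely many P.
   The argument is Liouville's, with the Mahler equation replacing the minimal
   polynomial. *)

(** * Polynomials acting on Laurent series, and the substitution T -> T^d *)

Section LaurentAction.
Variable F : fieldType.
Implicit Types (P Q : {poly F}) (h : int -> F) (n v : int).

(* h(T^d) *)
Definition lsubst (d : nat) h : int -> F :=
  fun n => if (d %| n)%Z then h (n %/ d)%Z else 0.

Lemma lpmul_widen m Q h n : (size Q <= m)%N ->
  lpmul Q h n = \sum_(d < m) Q`_d * h (n + d%:Z).
Proof.
move=> sQ; rewrite /lpmul (big_ord_widen _ (fun d => Q`_d * h (n + d%:Z)) sQ).
rewrite big_mkcond; apply: eq_bigr => d _; case: ltnP => // le_d.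
by rewrite nth_default ?mul0r.
Qed.

Lemma lpmulDl P Q h n : lpmul (P + Q) h n = lpmul P h n + lpmul Q h n.
Proof.
pose m := maxn (size P) (size Q).
rewrite !(lpmul_widen m) ?leq_maxl ?leq_maxr ?size_polyD // -big_split /=.
by apply: eq_bigr => d _; rewrite coefD mulrDl.
Qed.

Lemma lpmul0l h n : lpmul 0 h n = 0.
Proof. by rewrite /lpmul size_poly0 big_ord0. Qed.

Lemma lpmul_suml (I : Type) (r : seq I) (A : I -> {poly F}) h n :
  lpmul (\sum_(i <- r) A i) h n = \sum_(i <- r) lpmul (A i) h n.
Proof.
exact: (big_morph (fun P => lpmul P h n) (fun P Q => lpmulDl P Q h n)
  (lpmul0l h n)).
Qed.

Lemma lpmulNl Q h n : lpmul (- Q) h n = - lpmul Q h n.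
Proof. by apply/eqP; rewrite -subr_eq0 opprK -lpmulDl addNr lpmul0l. Qed.

Lemma lpmul_sumr (I : Type) (r : seq I) Q (h : I -> int -> F) n :
  lpmul Q (fun m => \sum_(i <- r) h i m) n = \sum_(i <- r) lpmul Q (h i) n.
Proof.
by rewrite /lpmul exchange_big; apply: eq_bigr => d _; rewrite mulr_sumr.
Qed.

Lemma lpmulBr Q h h' n :
  lpmul Q (lsub h h') n = lpmul Q h n - lpmul Q h' n.
Proof.
rewrite /lpmul -sumrB; apply: eq_bigr => d _.
by rewrite /lsub mulrBr.
Qed.

Lemma lpmulC c h n : lpmul c%:P h n = c * h n.
Proof.
by rewrite (lpmul_widen 1) ?size_polyC_leq1 // big_ord1 coefC addr0.
Qed.

Lemma lpmulMX Q h n : lpmul (Q * 'X) h n = lpmul Q h (n + 1).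
Proof.
rewrite (lpmul_widen (size Q).+1); last first.
  by rewrite (leq_trans (size_polyMleq _ _)) // size_polyX addn2.
rewrite big_ord_recl coefMX eqxx mul0r add0r; apply: eq_bigr => d _.
by rewrite coefMX /= -addrA.
Qed.

Lemma lpmulMXn Q j h n : lpmul (Q * 'X^j) h n = lpmul Q h (n + j%:Z).
Proof.
elim: j n => [|j IHj] n; first by rewrite expr0 mulr1 addr0.
by rewrite exprSr mulrA lpmulMX IHj intS addrA.
Qed.

Lemma lpmulZ c Q h n : lpmul (c *: Q) h n = c * lpmul Q h n.
Proof.
rewrite (lpmul_widen (size Q)) ?size_scale_leq // mulr_sumr.
by apply: eq_bigr => d _; rewrite coefZ mulrA.
Qed.

Lemma lpmulM P Q h n : lpmul (P * Q) h n = lpmul P (lpmul Q h) n.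
Proof.
elim/poly_ind: P n => [|P c IHP] n; first by rewrite mul0r !lpmul0l.
by rewrite mulrDl !lpmulDl lpmulC lpmulMX -IHP mulrAC lpmulMX mul_polyC lpmulZ.
Qed.

(** Seeing an embedded polynomial as its action on the series 1 makes the laws of [lpmul] apply to
    [polyL] as well. *)
Lemma polyLE P n : polyL P n = lpmul P (@lone F) n.
Proof.
rewrite /polyL /lpmul /lone; case: ifP => n0.
  have [le_n|lt_n] := leqP (size P) (absz n).
    rewrite nth_default // big1 // => d _.
    by have := ltn_ord d; case: eqP => [|_]; [lia | rewrite mulr0].
  rewrite (bigD1 (Ordinal lt_n)) //= big1 ?addr0.
    by rewrite (_ : n + _ = 0) ?mulr1 //; lia.
  move=> d; rewrite -val_eqE /= => /eqP neq_d.
  by case: eqP => [|_]; [lia | rewrite mulr0].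
rewrite big1 // => d _.
by case: eqP => [|_]; [lia | rewrite mulr0].
Qed.

Lemma lpmul_polyL P Q : lpmul P (polyL Q) = polyL (P * Q).
Proof.
apply: funext => n; rewrite polyLE lpmulM; congr (lpmul _ _ _).
by apply: funext => m; rewrite polyLE.
Qed.

Lemma lsubst_lsub d h h' :
  lsubst d (lsub h h') = lsub (lsubst d h) (lsubst d h').
Proof.
by apply: funext => n; rewrite /lsubst /lsub; case: ifP; rewrite ?subr0.
Qed.

Lemma lsubst_lone d : (0 < d)%N -> lsubst d (@lone F) = @lone F.
Proof.
move=> d0; apply: funext => n; rewrite /lsubst /lone; case: ifP => [dn|].
  have d_neq0 : d%:Z != 0 by lia.
  by rewrite -(divzK dn) mulzK // mulf_eq0 (negbTE d_neq0) orbF.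
by case: eqP => // ->; rewrite dvdz0.
Qed.

(** By Horner induction on Q: multiplication by T shifts indices by 1, and after the substitution by
    d. *)
Lemma lsubst_lpmul d Q h : (0 < d)%N ->
  lsubst d (lpmul Q h) = lpmul (Q \Po 'X^d) (lsubst d h).
Proof.
move=> d0; elim/poly_ind: Q => [|Q c IHQ]; apply: funext => n.
  by rewrite comp_poly0 lpmul0l /lsubst lpmul0l if_same.
rewrite comp_polyD comp_polyM comp_polyX comp_polyC lpmulDl lpmulMXn lpmulC.
rewrite -IHQ /lsubst rpredDr ?dvdzz // divzDr ?dvdzz // divzz.
case: ifP => _; last by rewrite mulr0 addr0.
by rewrite lpmulDl lpmulMX lpmulC; case: eqP => [|_] //; lia.
Qed.

Lemma lsubst_polyL d P : (0 < d)%N ->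
  lsubst d (polyL P) = polyL (P \Po 'X^d).
Proof.
move=> d0; rewrite (_ : polyL P = lpmul P (@lone F)).
  rewrite lsubst_lpmul // lsubst_lone //.
  by apply: funext => n; rewrite polyLE.
by apply: funext => n; rewrite polyLE.
Qed.

Lemma lpmul_vanish Q h v (d : nat) : (size Q <= d.+1)%N ->
  (forall n, n < v -> h n = 0) -> forall n, n < v - d%:Z -> lpmul Q h n = 0.
Proof.
move=> sQ h0 n lt_n; rewrite (lpmul_widen d.+1) // big1 // => i _.
by rewrite h0 ?mulr0 //; have := ltn_ord i; lia.
Qed.

Lemma lead_index_lpmul Q h v : Q != 0 -> lead_index h v ->
  lead_index (lpmul Q h) (v - (size Q).-1%:Z).
Proof.
move=> Q0 [hv h0]; split; last exact: lpmul_vanish (leqSpred _) h0.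
rewrite /lpmul (polySpred Q0) big_ord_recr /= subrK big1 ?add0r.
  by rewrite mulf_neq0 // -lead_coefE lead_coef_eq0.
by move=> i _; rewrite h0 ?mulr0 //; have := ltn_ord i; lia.
Qed.

Lemma lead_index_lsubst d h v : (0 < d)%N -> lead_index h v ->
  lead_index (lsubst d h) (d%:Z * v).
Proof.
move=> d0 [hv h0]; split.
  by rewrite /lsubst dvdz_mulr ?dvdzz // mulKz //; lia.
move=> n lt_n; rewrite /lsubst; case: ifP => // dn.
by apply: h0; rewrite ltz_divLR //; lia.
Qed.

Lemma lead_index_polyL P : P != 0 ->
  lead_index (polyL P) (- (size P).-1%:Z).
Proof.
move=> P0; split.
  rewrite /polyL (_ : _ <= 0); last by lia.
  by rewrite abszN /= -lead_coefE lead_coef_eq0.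
suff zero (n : int) : n < - (size P).-1%:Z -> polyL P n = 0 by exact: zero.
move=> lt_n; rewrite /polyL; case: ifP => // n0.
by rewrite nth_default // (polySpred P0); lia.
Qed.


(** * Upper bound for the order of f - P/Q *)

Lemma size_mul_pred P Q :
  ((size (P * Q)%R).-1 <= (size P).-1 + (size Q).-1)%N.
Proof.
have := size_polyMleq P Q; move: (size (P * Q)) (size P) (size Q); lia.
Qed.

(** The degree is deg Q times 1 + p + ... + p^(m-1), and this geometric sum is at most p^m because p
    >= 2. *)
Lemma size_prod_comp_Xn (p m : nat) Q : (1 < p)%N -> Q != 0 ->
  ((size (\prod_(i < m) (Q \Po 'X^(p ^ i)))%R).-1 <= (size Q).-1 * p ^ m)%N.
Proof.
move=> p1 Q0; elim: m => [|m IHm]; first by rewrite big_ord0 size_poly1.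
rewrite big_ord_recr /=; set W := \prod_(i < m) _ in IHm *.
apply: leq_trans (size_mul_pred _ _) _.
rewrite size_comp_poly size_polyXn /= expnS mulnCA.
apply: (@leq_trans (2 * ((size Q).-1 * p ^ m))).
  by rewrite mul2n -addnn leq_add2r.
by rewrite leq_mul.
Qed.

Lemma order_bound (p s a : nat) (A : nat -> {poly F}) (B P Q : {poly F})
    (f r : int -> F) (v : int) :
  (1 < p)%N -> (exists2 i, (i <= s)%N & A i != 0) ->
  (forall i, (i <= s)%N -> (size (A i) <= a.+1)%N) ->
  (forall n, \sum_(i < s.+1) lpmul (A i) (lsubst (p ^ i) f) n = polyL B n) ->
  Q != 0 -> lpmul Q r = polyL P -> lead_index (lsub f r) v -> 0 < v ->
  v <= (a + (size Q).-1 * p ^ s.+1)%N%:Z.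
Proof.
move=> p1 exA sA mahler Q0 Qr [ev e0] v0.
have pX i : (0 < p ^ i)%N by rewrite expn_gt0; lia.
pose Qs i := Q \Po 'X^(p ^ i); pose Ps i := P \Po 'X^(p ^ i).
pose W := \prod_(i < s.+1) Qs i.
(* W clears the denominators of all r(T^(p^i)), and [W' i] is the cofactor W / Q(T^(p^i)). Thus N is
   W times the sum of the A_i eps(T^(p^i)), with the Mahler equation used to write it as a
   polynomial; this is [NE]. *)
pose W' (i : 'I_s.+1) := \prod_(j < s.+1 | j != i) Qs j.
pose N := W * B - \sum_(i < s.+1) A i * W' i * Ps i.
have W_E (i : 'I_s.+1) : W = W' i * Qs i.
  by rewrite /W (bigD1 i) //= mulrC.
have Qs0 i : Qs i != 0.
  by rewrite /Qs comp_poly_eq0 ?size_polyXn ?ltnS.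
have W0 : W != 0 by apply/prodf_neq0 => i _.
have sW : ((size W).-1 <= (size Q).-1 * p ^ s.+1)%N.
  exact: size_prod_comp_Xn.
pose eps i := lsubst (p ^ i) (lsub f r).
have epsL i : lead_index (eps i) ((p ^ i)%N%:Z * v).
  exact: lead_index_lsubst.
have NE n : polyL N n = \sum_(i < s.+1) lpmul (W * A i) (eps i) n.
  rewrite polyLE lpmulDl -polyLE lpmulNl lpmul_suml -lpmul_polyL.
  rewrite -(_ : (fun m => \sum_(i < s.+1) lpmul (A i) (lsubst (p ^ i) f) m)
    = polyL B); last exact/funext.
  rewrite lpmul_sumr -sumrB; apply: eq_bigr => i _.
  rewrite /eps lsubst_lsub lpmulBr -[lpmul W _ _]lpmulM; congr (_ - _).
  rewrite -polyLE -lpmul_polyL -lsubst_polyL // -Qr lsubst_lpmul // -lpmulM.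
  by rewrite -/(Qs i) (W_E i); congr lpmul; rewrite [RHS]mulrC mulrA.
have vanish i n : (i <= s)%N ->
    n < (p ^ i)%N%:Z * v - ((size W).-1 + a)%N%:Z -> lpmul (W * A i) (eps i) n = 0.
  move=> le_i; apply: (lpmul_vanish _ _ _ _ _ (epsL i).2).
  rewrite (leq_trans (size_polyMleq _ _)) // (polySpred W0) addSn /= -addnS.
  by rewrite leq_add2l sA.
rewrite leNgt; apply/negP => lt_v.
(* If N is nonzero, its leading index -deg N is at most 0. The i-th summand vanishes below p^i v -
   deg W - a, which is positive by [lt_v] and [sW], so the leading coefficient of N would be 0. *)
have [N0|N0] := eqVneq N 0; last first.
  have [/eqP[]] := lead_index_polyL _ N0; rewrite NE big1 // => i _.
  apply: vanish; first by rewrite -ltnS.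
  have : v <= (p ^ i)%N%:Z * v by rewrite ler_peMl; lia.
  by lia.
have exA' : exists i, (i <= s)%N && (A i != 0).
  by have [i le_i Ai0] := exA; exists i; rewrite le_i.
case: (ex_minnP exA') => m /andP[le_m Am0] min_m.
have lt_m : (m < s.+1)%N by [].
have WA0 : W * A m != 0 by rewrite mulf_neq0.
have [/eqP[]] := lead_index_lpmul _ _ _ WA0 (epsL m).
(* Here n is the leading index of the m-th summand, and n <= p^m v - deg W. For i > m the i-th
   summand starts no earlier than 2 p^m v - deg W - a, which exceeds n since v > a; so nothing
   cancels the m-th one. *)
set n := (_ - _); have : polyL N n = 0 by rewrite N0 polyLE lpmul0l.
rewrite NE (bigD1 (Ordinal lt_m)) //= big1 ?addr0 // => i.
rewrite -val_eqE /= => neq_im.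
have [lt_im|le_mi] := ltnP i m.
  suff /eqP-> : A i == 0 by rewrite mulr0 lpmul0l.
  apply: contraLR lt_im => Ai0; rewrite -leqNgt min_m // Ai0 andbT.
  by rewrite -ltnS.
apply: vanish; first by rewrite -ltnS.
have lt_mi : (m < i)%N by rewrite ltn_neqAle eq_sym neq_im.
have sWA : ((size W).-1 <= (size (W * A m)%R).-1)%N.
  by rewrite size_mul // (polySpred Am0) addnS (polySpred W0) addSn leq_addr.
have p_im : (2 * p ^ m <= p ^ i)%N.
  by rewrite (leq_trans _ (leq_pexp2l (ltnW p1) lt_mi)) // expnS leq_mul2r p1 orbT.
have : (2 * p ^ m)%N%:Z * v <= (p ^ i)%N%:Z * v by rewrite ler_wpM2r; lia.
have : v <= (p ^ m)%N%:Z * v by rewrite ler_peMl //; have := pX m; lia.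
rewrite /n PoszM -mulrA; lia.
Qed.

End LaurentAction.

Arguments lsubst {F}.

(** * The Mahler equation from a finite p-kernel *)

Lemma mx_left_kernel (R : idomainType) (s : nat) (C : nat -> nat -> R) :
  exists v : nat -> R, (exists2 i, (i <= s)%N & v i != 0) /\
    forall j, (j < s)%N -> \sum_(i < s.+1) v i * C i j = 0.
Proof.
(* A zero column with index s makes the matrix square and singular; [det0P] then gives a kernel
   vector with entries in the domain R itself. *)
pose M : 'M[R]_s.+1 := \matrix_(i, j) if (j : nat) == s then 0 else C i j.
have /det0P[u u0 uM] : \det M == 0.
  rewrite -det_tr; apply/det0P; exists (delta_mx 0 ord_max).
    apply/eqP => /matrixP/(_ 0 ord_max)/eqP.
    by rewrite !mxE !eqxx oner_eq0.
  by apply/matrixP => i j; rewrite -rowE !mxE eqxx.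
exists (fun i => u 0 (inord i)); split.
  have /rV0Pn[i ui] := u0.
  by exists i; rewrite ?inord_val // -ltnS.
move=> j lt_j; have /matrixP/(_ 0 (inord j)) := uM.
rewrite !mxE.
move=> E; rewrite -[RHS]E; apply: eq_bigr => i _.
by rewrite !mxE inord_val inordK ?ltnS 1?ltnW // ltn_eqF.
Qed.

Section Mahler.
Variable F : fieldType.

(** The series sum of x_m T^(-m), with no positive powers of T: the p-kernel only sees indices i >=
    0. *)
Definition seqL (x : nat -> F) : int -> F :=
  fun n => if n is Posz m then x m else 0.

(** Sorting indices by residue modulo d: x(T) is the sum of T^(-r) x_r(T^d), where x_r(N) = x(dN +
    r). *)
Lemma seqL_split (d : nat) (x : nat -> F) (m : int) : (0 < d)%N ->
  seqL x m =
  \sum_(r < d) lsubst d (seqL (fun N => x (d * N + r)%N)) (m - r%:Z).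
Proof.
move=> d0.
have d_neq0 : d%:Z != 0 by lia.
have mod0 := modz_ge0 m d_neq0.
have mod_lt : (m %% d)%Z < d%:Z by apply: ltz_pmod; lia.
have lt_r : (absz (m %% d)%Z < d)%N by lia.
rewrite (bigD1 (Ordinal lt_r)) //= big1 ?addr0; last first.
  move=> r; rewrite -val_eqE /= => /eqP neq_r; rewrite /lsubst.
  case: ifP => //; rewrite -eqz_mod_dvd => /eqP.
  by rewrite [(r%:Z %% d)%Z]modz_small; have := ltn_ord r; lia.
have E := divz_eq m d; set r := absz _ in lt_r *; set q := (m %/ d)%Z in E *.
have mE : m - r%:Z = q * d%:Z by rewrite {1}E /r gez0_abs ?addrK.
rewrite /lsubst mE dvdz_mull ?dvdzz // mulzK //.
have {}E : m = q * d%:Z + r%:Z by rewrite -mE subrK.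
move: r q E lt_r {mod0 mod_lt mE} => r [q|q] E lt_r /=.
  by rewrite E -PoszM -PoszD mulnC.
(* A negative quotient forces m < 0, because r < d; both sides are then 0. *)
by case: m E => // m; rewrite NegzE; nia.
Qed.

Lemma lsubst_mul (q d : nat) (h : int -> F) (m : int) : (0 < q)%N ->
  lsubst (q * d) h (q%:Z * m) = lsubst d h m.
Proof. by move=> q0; rewrite /lsubst PoszM dvdz_mul2l ?divzMpl //; lia. Qed.

(** This is [seqL_split] after T -> T^q. Off the multiples of q both sides are 0, since qd and the
    shifts qr are multiples of q. *)
Lemma lsubst_seqL_split (q d : nat) (x : nat -> F) (n : int) :
  (0 < q)%N -> (0 < d)%N ->
  lsubst q (seqL x) n = \sum_(r < d)
    lsubst (q * d) (seqL (fun N => x (d * N + r)%N)) (n - (q * r)%N%:Z).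
Proof.
move=> q0 d0; have q_neq0 : q%:Z != 0 by lia.
have [qn|qn] := boolP (q %| n)%Z.
  rewrite -(divzK qn) mulrC -[X in lsubst X _]muln1 lsubst_mul //.
  rewrite {1}/lsubst dvd1z divz1 (seqL_split d) //.
  by apply: eq_bigr => r _; rewrite PoszM -mulrBr lsubst_mul.
rewrite {1}/lsubst (negbTE qn) big1 // => r _; rewrite /lsubst.
case: ifP => // /(dvdz_trans _) qd; case/negP: qn.
have /qd : (q%:Z %| (q * d)%N%:Z)%Z by rewrite PoszM dvdz_mulr ?dvdzz.
by rewrite PoszM rpredBr // dvdz_mulr ?dvdzz.
Qed.

Lemma mahler_seqL (p s : nat) (a : nat -> F) : (1 < p)%N ->
  (p_kernel p a #= `I_s)%card ->
  exists A : nat -> {poly F}, (exists2 i, (i <= s)%N & A i != 0) /\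
    forall n, \sum_(i < s.+1) lpmul (A i) (lsubst (p ^ i) (seqL a)) n = 0.
Proof.
move=> p1 /card_set_bijP[c [c_fun c_inj c_surj]].
(* Enumerates the kernel as b_0, ..., b_(s-1) by inverting the bijection c; indices outside its
   image get the default a. *)
have [b b_c] : exists b : nat -> nat -> F, forall x, p_kernel p a x -> b (c x) = x.
  have ex_b (j : nat) : exists y, forall x, p_kernel p a x -> c x = j -> y = x.
    have [[x [Kx cx]]|no] := pselect (exists x, p_kernel p a x /\ c x = j).
      by exists x => x' Kx' cx'; apply: c_inj; rewrite ?inE // cx cx'.
    by exists a => x Kx cx; case: no; exists x.
  by have [b bP] := choice ex_b; exists b => x Kx; apply: bP Kx _.
(* Splitting a(T^(p^i)) with d = p^(s-i) puts every piece in the variable T^(p^s), whatever i is.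
   The factor T^M turns the shifts T^(-p^i r) into polynomials, as p^i r <= M, and [C i j] gathers
   those whose piece is b_j. *)
pose M := (p ^ s)%N.
pose x i r := fun N => a (p ^ (s - i) * N + r)%N.
have Kx i r : (r < p ^ (s - i))%N -> p_kernel p a (x i r).
  by move=> lt_r; exists (s - i)%N, r.
pose C i j : {poly F} := \sum_(r < p ^ (s - i))
  if c (x i r) == j then 'X^(M - p ^ i * r) else 0.
(* There are s+1 rows, one for each i <= s, and only s kernel elements, hence a relation that kills
   every b_j. *)
have [v [v0 vC]] := mx_left_kernel _ s C.
exists (fun i => v i * 'X^M); split.
  have [i le_i vi] := v0.
  by exists i => //; rewrite mulf_neq0 // -size_poly_eq0 size_polyXn.
move=> n.
have pX i : (0 < p ^ i)%N by rewrite expn_gt0; lia.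
have XE e h m : lpmul ('X^e : {poly F}) h m = h (m + e%:Z).
  by rewrite -['X^e]mul1r lpmulMXn lpmulC mul1r.
have row i : (i <= s)%N -> lpmul 'X^M (lsubst (p ^ i) (seqL a)) =
    fun m => \sum_(j < s) lpmul (C i j) (lsubst M (seqL (b j))) m.
  move=> le_i; apply: funext => m.
  rewrite XE (lsubst_seqL_split (p ^ i) (p ^ (s - i))) // -expnD subnKC //.
  under [RHS]eq_bigr => j _ do rewrite lpmul_suml.
  rewrite exchange_big; apply: eq_bigr => r _.
  have lt_c : (c (x i r) < s)%N by apply: c_fun; apply: Kx.
  rewrite (bigD1 (Ordinal lt_c)) //= eqxx big1 ?addr0; last first.
    by move=> j; rewrite -val_eqE eq_sym => /negbTE/= ->; rewrite lpmul0l.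
  rewrite b_c; last exact: Kx.
  have le_M : (p ^ i * r <= M)%N.
    by rewrite /M -[X in (_ <= p ^ X)%N](subnKC le_i) expnD leq_mul2l ltnW ?orbT.
  by rewrite XE -subzn // addrA.
transitivity (\sum_(i < s.+1) \sum_(j < s)
    lpmul (v i * C i j) (lsubst M (seqL (b j))) n).
  apply: eq_bigr => i _; rewrite lpmulM row ?lpmul_sumr; last by rewrite -ltnS.
  by apply: eq_bigr => j _; rewrite lpmulM.
rewrite exchange_big big1 // => j _.
by rewrite -lpmul_suml vC // lpmul0l.
Qed.

Lemma mahler_equation (p s k : nat) (f : int -> F) : (1 < p)%N ->
  bounded_below f k -> (p_kernel p (fun i => f (Posz i)) #= `I_s)%card ->
  exists (A : nat -> {poly F}) (B : {poly F}),
    (exists2 i, (i <= s)%N & A i != 0) /\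
    forall n, \sum_(i < s.+1) lpmul (A i) (lsubst (p ^ i) f) n = polyL B n.
Proof.
move=> p1 fk /(mahler_seqL _ _ _ p1)[A [A0 rel]].
have pX i : (0 < p ^ i)%N by rewrite expn_gt0; lia.
(* The part of f with positive powers of T; its constant coefficient is 0 because index 0 already
   belongs to the sequence. Its contribution becomes B. *)
pose h := \poly_(m < k.+1) if m == 0 then 0 else f (- m%:Z).
exists A, (\sum_(i < s.+1) A i * (h \Po 'X^(p ^ i))); split => // n.
have fE : seqL (fun i => f (Posz i)) = lsub f (polyL h).
  apply: funext => -[m|m]; rewrite /lsub /polyL /=.
    case: m => [|m] /=; last by rewrite subr0.
    by rewrite coef_poly /= subr0.
  rewrite coef_poly /= ltnS; case: ltnP => [_|le_k]; first by rewrite NegzE subrr.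
  by rewrite subr0 fk // NegzE; lia.
apply/eqP; rewrite -subr_eq0 polyLE lpmul_suml -sumrB -[X in _ == X](rel n) fE.
apply/eqP/eq_bigr => i _.
by rewrite lsubst_lsub lpmulBr lsubst_polyL // lpmul_polyL polyLE.
Qed.

End Mahler.

(** * Finiteness of the good rational approximations *)

Section Approximation.
Variables (R : realType) (F : finFieldType).

Lemma finite_poly_size (m : nat) :
  finite_set [set P : {poly F} | (size P <= m)%N].
Proof.
apply: (@sub_finite_set _ _ (range (fun t : m.-tuple F => Poly t))).
  move=> P /= sP; exists [tuple P`_i | i < m] => //.
  apply/polyP => i; rewrite coef_Poly; have [lt_i|le_i] := ltnP i m.
    by rewrite -[i]/(val (Ordinal lt_i)) -tnth_nth tnth_mktuple.
  by rewrite !nth_default // ?(leq_trans sP) // size_tuple.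
exact/finite_image/finite_finset.
Qed.

Lemma lnorm_lead_index (base : R) (h : int -> F) (v : int) :
  lead_index h v -> lnorm base h = base ^ (- v).
Proof.
move=> hv; rewrite /lnorm asboolT; last by exists v.
rewrite (xget_unique 0 hv) // => w hw.
by case: (ltgtP w v) => // [/hv.2/eqP|/hw.2/eqP];
  rewrite ?(negbTE hv.1) ?(negbTE hw.1).
Qed.

Lemma lead_index_exists (h : int -> F) (k : nat) (n : int) :
  bounded_below h k -> h n != 0 -> exists v, lead_index h v.
Proof.
move=> hk hn.
have le_n : - k%:Z <= n.
  by rewrite leNgt; apply: contra hn => /hk/eqP.
have ex_m : exists m : nat, h (m%:Z - k%:Z) != 0.
  by exists (absz (n + k%:Z)); rewrite gez0_abs ?addrK //; lia.
case: (ex_minnP ex_m) => m hm min_m; exists (m%:Z - k%:Z); split => //.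
move=> i lt_i; apply/eqP; apply: contraT => hi.
suff zero (j : int) : j < m%:Z - k%:Z -> h j = 0 by rewrite zero ?eqxx in hi.
move=> {i lt_i hi} lt_j; have [/hk //|le_j] := ltP j (- k%:Z).
apply/eqP; apply: contraT => hj.
have jE : j = (absz (j + k%:Z))%:Z - k%:Z by lia.
by move: hj; rewrite jE => /min_m; lia.
Qed.

(** Taking logarithms to base |T| turns the norm inequality into one between orders. Irrationality
    makes f - r nonzero, so that it has a leading index. *)
Lemma approx_sol_order (base tau : R) (f : int -> F) (k : nat)
    (P Q : {poly F}) :
  1 < base -> bounded_below f k -> ~ lrational f ->
  approx_sol base f tau (P, Q) ->
  exists (r : int -> F) (v : int), [/\ lpmul Q r = polyL P,
    lead_index (lsub f r) v & (size Q).-1%:R * tau < v%:~R].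
Proof.
move=> base1 fk irr [/= Q0 [r [[k' rk] [Qr lt_r]]]].
have base0 : 0 < base by exact: lt_trans base1.
have [n en] : exists n, lsub f r n != 0.
  apply: contrapT => no; apply: irr; exists P, Q; split => //.
  rewrite -Qr; congr lpmul; apply: funext => n; apply/eqP; rewrite -subr_eq0.
  by apply: contraT => en; case: no; exists n.
have ek : bounded_below (lsub f r) (maxn k k').
  by move=> i lt_i; rewrite /lsub fk ?rk ?subrr //; lia.
have [v ev] := lead_index_exists _ _ _ ek en.
exists r, v; split => //.
move: lt_r; rewrite (lnorm_lead_index _ _ _ ev).
rewrite (lnorm_lead_index _ _ _ (lead_index_polyL _ _ Q0)) opprK.
rewrite -!powR_intmul ?ltW // -powRrM.
rewrite ltNge [_ < v%:~R]ltNge; apply: contra => le_v.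
by apply: (ler_powR (ltW base1)); rewrite mulrN mulrNz lerN2 -pmulrn.
Qed.

Lemma finite_approx_sol (base tau : R) (p s k : nat) (f : int -> F) :
  1 < base -> (1 < p)%N -> bounded_below f k -> ~ lrational f ->
  (p_kernel p (fun i => f (Posz i)) #= `I_s)%card ->
  (p ^ s.+1)%:R < tau -> finite_set [set PQ | approx_sol base f tau PQ].
Proof.
move=> base1 p1 fk irr /(mahler_equation _ _ _ _ _ p1 fk)[A [B [A0 rel]]] lt_tau.
have tau0 : 0 < tau by apply: le_lt_trans lt_tau.
pose a := \max_(i < s.+1) size (A i).
have sA i : (i <= s)%N -> (size (A i) <= a.+1)%N.
  by move=> le_i; apply/leqW/(leq_bigmax (Ordinal (le_i : (i < s.+1)%N))).
(* From deg Q * tau < v <= a + deg Q * p^(s+1) follows deg Q < a / (tau - p^(s+1)), so b bounds deg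
   Q. *)
pose b := Num.Def.archi_bound (a%:R / (tau - (p ^ s.+1)%:R)).
apply: (@sub_finite_set _ _
  ([set P : {poly F} | (size P <= b + k.+1)%N] `*`
     [set Q : {poly F} | (size Q <= b.+1)%N])); last first.
  exact/finite_setX/finite_poly_size/finite_poly_size.
move=> [P Q] sol; have Q0 : Q != 0 by case: sol.
have [r [v [Qr ev lt_v]]] := approx_sol_order _ _ _ _ _ _ base1 fk irr sol.
have v0 : 0 < v.
  by rewrite -(ltr0z R); apply: le_lt_trans lt_v; rewrite mulr_ge0 // ltW.
have le_v := order_bound _ _ _ _ _ _ _ _ _ _ _ p1 A0 sA rel Q0 Qr ev v0.
have sQ : ((size Q).-1 < b)%N.
  rewrite -(ltr_nat R); apply: le_lt_trans (archi_boundP _); last first.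
    by rewrite divr_ge0 // subr_ge0 ltW.
  rewrite ler_pdivlMr ?subr_gt0 // mulrBr lerBlDr ltW //.
  apply: lt_le_trans lt_v _.
  by rewrite -natrM -natrD pmulrn ler_int.
split => /=; last by rewrite (polySpred Q0) ltnW.
(* P = Q f - Q (f - r). At index -m with m > b + k, the first term vanishes since f starts at -k or
   later, the second since f - r starts at v > 0. *)
apply/leq_sizeP => m le_m.
have PE : polyL P (- m%:Z) = P`_m by rewrite /polyL oppr_le0 abszN.
have sQ1 : (size Q <= b.+1)%N by rewrite (polySpred Q0) ltnW.
rewrite -PE -Qr -[LHS](subKr (lpmul Q f (- m%:Z))) -lpmulBr.
rewrite (lpmul_vanish _ _ _ _ _ sQ1 fk); last by lia.
by rewrite (lpmul_vanish _ _ _ _ _ sQ1 ev.2) ?subr0 //; lia.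
Qed.

End Approximation.

Theorem theorem1p2 (R : realType) (base : R) (p : nat) (F : finFieldType)
    (k : nat) (f : int -> F) (s e : nat) :
  prime p -> p \in [pchar F] -> 1 < base ->
  bounded_below f k -> lalgebraic k f -> ~ lrational f ->
  (p_kernel p (fun i : nat => f i%:Z) #= `I_s)%card ->
  min_states p (fun i : nat => f i%:Z) e ->
  (irr_exponent base f <= ((p ^ s.+1 * e)%N%:R : R)%:E)%E.
Proof.
move=> /prime_gt1 p1 _ base1 fk _ irr kernel [[M [_ <-]] _].
(* An automaton has an initial state, so e >= 1 and p^(s+1) <= p^(s+1) e. *)
have states_gt0 : (0 < #|dfao_state M|)%N.
  by apply/card_gt0P; exists (dfao_init M).
apply: ge_ereal_sup => _ [tau inf <-]; rewrite lee_fin leNgt.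
apply/negP => lt_tau; apply: inf.
apply: finite_approx_sol base1 p1 fk irr kernel _.
by apply: le_lt_trans lt_tau; rewrite ler_nat leq_pmulr.
Qed.
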